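(* Let $d\ge 3$, $V\in L_{1,loc}(\mathbf{R}^d)$, $V\ge 0$, let $m>1$ be an integer and $\theta\in(0,1)$. Suppose that for each $\vec l\in\mathbf{Z}^d$ a sequence $\{D_j(\vec l)\}_{j=1}^\infty$ of subsets of $Q_1(\vec l)$ forms a $(\log_m,\theta)$-dense system in $Q_1(\vec l)$, and that $\Xi_n(\vec l,j)\neq\emptyset$ for all $\vec l\in\mathbf{Z}^d$, $n\in\mathbf{N}$, $j\in\{1,\dots,n\}$. Let $\gamma:(0,r_0)\to(0,1)$, $r_0>1/m$, be a nondecreasing function with $\limsup_{r\downarrow0}r^{-2}\gamma(r)=\infty$, and put $\psi(m,n)=\gamma(m^{-n})\,\mathrm{mes}_d(Q(\vec 0,n))$. Suppose that for every natural $n\ge1$ $$\lim_{|\vec l|\to\infty}\ \min_{\vec\xi\in\bigcup_{j=1}^n\Xi_n(\vec l,j)}V^\star\big(\psi(m,n);\,Q(\vec\xi,n)\big)=\infty .$$ Then there exist $\bar r_0>0$ and a function $\bar\gamma:(0,\bar r_0]\to(0,1)$ with $\limsup_{r\downarrow0}r^{-2}\bar\gamma(r)=\infty$ such that for every $r\in(0,\bar r_0]$ $$\lim_{|y|\to\infty}V^\star\big(\bar\gamma(r)\,\mathrm{mes}_d(Q_r(y));\,Q_r(y)\big)=\infty .$$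
   Context: $\mathrm{mes}_d$ is Lebesgue measure on $\mathbf{R}^d$; $Q=[0,1]^d$, $Q_r(y)=rQ+y$. $[x]$ is the integer part of $x$. For a measurable set $E\subseteq\mathbf{R}^d$, nonnegative measurable $W$ on $E$ and $t>0$: $W^\star(t;E)=\sup\{s>0:\ \mathrm{mes}_d(\{x\in E: W(x)\ge s\})\ge t\}$ (with $\sup\emptyset=0$). A regular parallelepiped is a set of the form $\prod_{k=1}^d[a_k,b_k]$. A sequence $\{D_n\}_{n=1}^\infty$ of subsets of a cube $Q_1(y)$ is a $(\log_m,\theta)$-dense system in $Q_1(y)$ if (a) each $D_n$ is a finite union of regular parallelepipeds; (b) for any cube $Q_r(z)\subseteq Q_1(y)$ with $0<r<\min\{1,\frac1{\theta m^2}\}$ there is $j\in\{1,2,\dots,[\log_m(\frac1{\theta r})]\}$ such that for some regular parallelepiped $\Pi\subseteq D_j$ there is a cube $Q_{\theta r}(s)$ contained in $\Pi\cap Q_r(z)$. For $\vec\xi\in m^{-n}\mathbf{Z}^d$: $Q(\vec\xi,n)=Q_{m^{-n}}(\vec\xi)$; and $\Xi_n(\vec l,j)=\{\vec\xi\in m^{-n}\mathbf{Z}^d:\ Q(\vec\xi,n)\subseteq D_j(\vec l)\}$. *)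

(* Defs.v *)
From HB Require Import structures.
From mathcomp Require Import all_boot all_order all_algebra.
From mathcomp Require Import all_classical all_reals all_analysis.

Set Implicit Arguments.
Unset Strict Implicit.
Unset Printing Implicit Defensive.
Import Order.TTheory GRing.Theory Num.Theory.
Import numFieldNormedType.Exports.

Local Open Scope classical_set_scope.
Local Open Scope ring_scope.

(* The library has Lebesgue measure on R only.  The product of n copies
   of a sigma-finite measure is built below as a measure on n-tuples; applied to
   the Lebesgue measure of R it gives the Lebesgue measure on the Borel sets of
   R^d, from which the (complete) Lebesgue measure [mes] is then obtained. *)
Section power_measure.
Context d (T : measurableType d) (R : realType).
Local Open Scope ereal_scope.

Section cons.
Variable n : nat.

Definition tuple_cons (p : T * n.-tuple T) : n.+1.-tuple T :=
  [tuple of p.1 :: p.2].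

Definition tuple_uncons (t : n.+1.-tuple T) : T * n.-tuple T :=
  (thead t, [tuple of behead t]).

Lemma tuple_consK : cancel tuple_cons tuple_uncons.
Proof. by case=> x t; congr (_, _); apply/val_inj. Qed.

Lemma tuple_unconsK : cancel tuple_uncons tuple_cons.
Proof. by move=> t; rewrite [RHS]tuple_eta; apply/val_inj. Qed.

Lemma measurable_tuple_cons : measurable_fun setT tuple_cons.
Proof. exact: measurable_cons. Qed.

Lemma measurable_tuple_uncons : measurable_fun setT tuple_uncons.
Proof.
apply/measurable_fun_pairP; split; first exact: measurable_tnth.
exact: measurable_behead.
Qed.

Variables (m1 : {sigma_finite_measure set T -> \bar R})
  (m2 : {sigma_finite_measure set (n.-tuple T) -> \bar R}).

Definition cons_measure (A : set (n.+1.-tuple T)) : \bar R :=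
  (m1 \x m2) (tuple_cons @^-1` A).

Let measurable_preimage_cons A : measurable A -> measurable (tuple_cons @^-1` A).
Proof.
by move=> mA; rewrite -[X in measurable X]setTI; exact: measurable_tuple_cons.
Qed.

Let cons_measure0 : cons_measure set0 = 0.
Proof. by rewrite /cons_measure preimage_set0 measure0. Qed.

Let cons_measure_ge0 A : 0 <= cons_measure A.
Proof. exact: measure_ge0. Qed.

Let cons_measure_sigma_additive : semi_sigma_additive cons_measure.
Proof.
move=> F mF tF mUF; rewrite /cons_measure preimage_bigcup.
apply: measure_semi_sigma_additive.
- by move=> i; exact: measurable_preimage_cons.
- apply/trivIsetP => /= i j _ _ ij; rewrite -preimage_setI.
  by move/trivIsetP : tF => /(_ _ _ _ _ ij) ->//; rewrite preimage_set0.
- by rewrite -preimage_bigcup; exact: measurable_preimage_cons.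
Qed.

HB.instance Definition _ := isMeasure.Build _ _ _ cons_measure
  cons_measure0 cons_measure_ge0 cons_measure_sigma_additive.

Let cons_measure_sigma_finite : sigma_finite setT cons_measure.
Proof.
have /sigma_finiteP[F [TF ndF Foo]] := sigma_finiteT m1.
have /sigma_finiteP[G [TG ndG Goo]] := sigma_finiteT m2.
exists (fun i => tuple_uncons @^-1` (F i `*` G i)).
  rewrite -preimage_bigcup -[LHS](preimage_setT tuple_uncons); congr (_ @^-1` _).
  rewrite -setXTT TF TG predeqE => -[x y]; split.
    move=> [/= [i _ Fix] [k _ Gky]]; exists (maxn i k) => //; split.
    - by move: x Fix; exact/subsetPset/ndF/leq_maxl.
    - by move: y Gky; exact/subsetPset/ndG/leq_maxr.
  by move=> [i _ []/= ? ?]; split; exists i.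
move=> i; have [? ?] := Foo i; have [? ?] := Goo i.
have mFG : measurable (F i `*` G i) by exact: measurableX.
split; first by rewrite -[X in measurable X]setTI; exact: measurable_tuple_uncons.
rewrite /cons_measure -comp_preimage.
rewrite (_ : _ \o _ = id); last by rewrite funeqE => p /=; rewrite tuple_consK.
by rewrite preimage_id product_measure1E// lte_mul_pinfty// ge0_fin_numE.
Qed.

HB.instance Definition _ := Measure_isSigmaFinite.Build _ _ _ cons_measure
  cons_measure_sigma_finite.

End cons.

Variable m : {sigma_finite_measure set T -> \bar R}.

Fixpoint power_measure n : {sigma_finite_measure set (n.-tuple T) -> \bar R} :=
  if n is k.+1 then cons_measure m (power_measure k) else \d_[tuple].

Lemma measurable_tuple_rect n (A : 'I_n -> set T) :
  (forall i, measurable (A i)) ->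
  measurable [set t : n.-tuple T | forall i, A i (tnth t i)].
Proof.
move=> mA; rewrite (_ : mkset _ =
    \bigcap_(i in [set: 'I_n]) [set t : n.-tuple T | A i (tnth t i)]).
  apply: fin_bigcap_measurable => // i _.
  by rewrite -[X in measurable X]setTI; exact: measurable_tnth.
by apply/seteqP; split => [t At i _|t At i]; exact: At.
Qed.

Lemma power_measure_rect n (A : 'I_n -> set T) :
  (forall i, measurable (A i)) ->
  power_measure n [set t | forall i, A i (tnth t i)] = \prod_i m (A i).
Proof.
elim: n => [|n IHn] in A * => mA.
  by rewrite big_ord0 /= diracE mem_set// => -[].
rewrite big_ord_recl -(IHn (fun i => A (lift ord0 i)))//=.
rewrite -product_measure1E//; last first.
  by apply: (@measurable_tuple_rect _ (fun i => A (lift ord0 i))) => i; exact: mA.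
congr (product_measure1 _ _ _); apply/seteqP; split => -[x t] /=.
  move=> At; split => [|i]; first exact: (At ord0).
  by have := At (lift ord0 i); rewrite tnthS.
move=> [Ax At] i; case: (unliftP ord0 i) => [j|] ->; last exact: Ax.
by rewrite tnthS.
Qed.

End power_measure.

Section lebesgue_measure_rV.
Context {R : realType} {d : nat}.
Local Open Scope ereal_scope.

Definition row_of_tuple (t : d.-tuple (measurableTypeR R)) : 'rV[R]_d :=
  \row_i tnth t i.

Definition lebesgue_outer (A : set 'rV[R]_d) : \bar R :=
  ((power_measure lebesgue_measure d)^*)%mu (row_of_tuple @^-1` A).

Let lebesgue_outer0 : lebesgue_outer set0 = 0.
Proof. by rewrite /lebesgue_outer preimage_set0 outer_measure0. Qed.

Let lebesgue_outer_ge0 A : 0 <= lebesgue_outer A.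
Proof. exact: outer_measure_ge0. Qed.

Let le_lebesgue_outer : {homo lebesgue_outer : A B / A `<=` B >-> A <= B}.
Proof. by move=> A B AB; apply: le_outer_measure => t /=; exact: AB. Qed.

Let lebesgue_outer_sigma_subadditive : sigma_subadditive lebesgue_outer.
Proof.
move=> F; rewrite /lebesgue_outer preimage_bigcup.
exact: outer_measure_sigma_subadditive.
Qed.

HB.instance Definition _ := isOuterMeasure.Build R 'rV[R]_d lebesgue_outer
  lebesgue_outer0 lebesgue_outer_ge0 le_lebesgue_outer
  lebesgue_outer_sigma_subadditive.

(* R^d with the sigma-algebra of all Lebesgue measurable sets. *)
Definition lebesgue_rV := caratheodory_type lebesgue_outer.

HB.instance Definition _ := Measurable.on lebesgue_rV.

Definition mes : set lebesgue_rV -> \bar R := lebesgue_outer.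

HB.instance Definition _ := isMeasure.Build _ lebesgue_rV R mes
  (@caratheodory_measure0 R 'rV[R]_d lebesgue_outer)
  (@caratheodory_measure_ge0 R 'rV[R]_d lebesgue_outer)
  (@caratheodory_measure_sigma_additive R 'rV[R]_d lebesgue_outer).

Definition box (a b : 'rV[R]_d) : set 'rV[R]_d :=
  [set x : 'rV[R]_d | forall k, (a 0 k <= x 0 k <= b 0 k)%R].

Let side (a b : 'rV[R]_d) (k : 'I_d) : set (measurableTypeR R) :=
  `[(a 0 k)%R, (b 0 k)%R]%classic.

Let measurable_side a b k : measurable (side a b k).
Proof. exact: measurable_itv. Qed.

Let preimage_row_box (a b : 'rV[R]_d) : row_of_tuple @^-1` box a b =
  [set t | forall k, side a b k (tnth t k)].
Proof.
by apply/seteqP; split => t /= tab k; have := tab k; rewrite /side /= mxE in_itv.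
Qed.

Lemma measurable_box (a b : 'rV[R]_d) : measurable (box a b : set lebesgue_rV).
Proof.
suff mB : (((power_measure lebesgue_measure d)^*)%mu).-caratheodory
    (row_of_tuple @^-1` box a b) by move=> X; exact: mB.
apply: sub_caratheodory; apply: sub_sigma_algebra.
rewrite preimage_row_box.
exact: measurable_tuple_rect (measurable_side a b).
Qed.

Lemma mes_box (a b : 'rV[R]_d) : (forall k, (a 0 k <= b 0 k)%R) ->
  mes (box a b) = (\prod_k (b 0 k - a 0 k))%:E.
Proof.
move=> ab; rewrite /mes /lebesgue_outer preimage_row_box.
rewrite measurable_mu_extE; last first.
  exact: measurable_tuple_rect (measurable_side a b).
transitivity (\prod_k lebesgue_measure (side a b k)).
  exact: (power_measure_rect _ (measurable_side a b)).
rewrite -prodEFin; apply: eq_bigr => k _.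
rewrite /side lebesgue_measure_itv/= lte_fin; case: ltP => [_|ba].
  by rewrite EFinB.
by rewrite (@le_anti _ _ (a 0 k) (b 0 k))%R ?subrr// ab ba.
Qed.

End lebesgue_measure_rV.
Arguments lebesgue_rV : clear implicits.

Section definitions.
Context {R : realType} {d : nat}.
Implicit Types (x y z : 'rV[R]_d) (E P : set 'rV[R]_d) (V W : 'rV[R]_d -> R).

Definition L1loc V := forall K : set 'rV[R]_d, compact K ->
  (mes : set (lebesgue_rV R d) -> \bar R).-integrable K (EFin \o V).

Definition cube (r : R) y : set 'rV[R]_d :=
  [set r *: x + y | x in box 0 (const_mx 1)].

(* The added element 0 is the convention sup(empty) = 0.  The value is an
   extended real, and so is t, which is a multiple of the measure of a cube. *)
Definition Vstar W (t : \bar R) E : \bar R :=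
  ereal_sup (0%E |` [set s%:E | s in
    [set s : R | 0 < s /\ (t <= mes (E `&` [set x | (s <= W x)%R]))%E]]).

Definition parallelepiped P :=
  exists a b : 'rV[R]_d, (forall k, a 0 k <= b 0 k) /\ P = box a b.

Definition logb (m : nat) (x : R) : R := ln x / ln m%:R.

(* Only the terms D 1, D 2, ... of the sequence are constrained or used. *)
Definition dense_system (m : nat) (theta : R) y (D : nat -> set 'rV[R]_d) :=
  [/\ forall n, (1 <= n)%N -> D n `<=` cube 1 y,
      forall n, (1 <= n)%N -> exists F : set (set 'rV[R]_d),
        [/\ finite_set F, F `<=` parallelepiped & D n = \bigcup_(P in F) P]
    & forall r z, 0 < r -> r < Num.min 1 (1 / (theta * m%:R ^+ 2)) ->
        cube r z `<=` cube 1 y ->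
        exists j : nat,
          [/\ (1 <= j)%N, j%:Z <= Num.floor (logb m (1 / (theta * r)))
            & exists P s, [/\ parallelepiped P, P `<=` D j
                & cube (theta * r) s `<=` P `&` cube r z]]].

Definition intvec (k : 'rV[int]_d) : 'rV[R]_d := map_mx intr k.

Definition lattice (m n : nat) : set 'rV[R]_d :=
  [set m%:R ^- n *: intvec k | k in [set: 'rV[int]_d]].

Definition cubem (m n : nat) (xi : 'rV[R]_d) := cube (m%:R ^- n) xi.

Definition Xi (m n : nat) (Dj : set 'rV[R]_d) : set 'rV[R]_d :=
  [set xi | lattice m n xi /\ cubem m n xi `<=` Dj].

Definition psi (gamma : R -> R) (m n : nat) : \bar R :=
  ((gamma (m%:R ^- n))%:E * mes (cubem m n 0))%E.

(* The filter |i t| -> infinity on T.  The norm is the library's (sup) norm on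
   row vectors; every norm on R^d yields the same filter. *)
Definition to_infty (T : Type) (i : T -> 'rV[R]_d) : set_system T :=
  filter_from [set: R] (fun M => [set t | M < `|i t|]).

End definitions.

(* Main.v *)
Require Import Defs.
From mathcomp Require Import all_boot all_order all_algebra.
From mathcomp Require Import all_classical all_reals all_analysis.
From mathcomp Require Import ring lra.

Set Implicit Arguments.
Unset Strict Implicit.
Unset Printing Implicit Defensive.
Import Order.TTheory GRing.Theory Num.Theory.
Import numFieldNormedType.Exports.

Local Open Scope classical_set_scope.
Local Open Scope ring_scope.

(** Only the monotonicity of [Vstar] matters: it increases when the set
    grows and when the threshold drops. Given a small [r] and any [y], a
    cube [Q_(r/2)(z)] contained in [Q_r(y)] also lies in a unit cube
    [Q_1(l)] with integer corner near [y] ([half_cube_in_unit_cube]). By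
    density some [D_j(l)] contains a cube of side [theta r / 2] inside
    [Q_(r/2)(z)], and that cube contains a lattice cube [Q(xi, n)] as soon
    as [2 m^(-n) <= theta r / 2] ([dense_system_Xi]). An exponent [n] for
    which this holds, which bounds every admissible [j], and for which
    [m^(-n)] is at least [c r] with [c = theta / (2 m^2)], depends on [r]
    only ([exists_exponent]).

    Set [gammabar r = c^d gamma (c r)]. As [c r <= m^(-n)] and [gamma] is
    nondecreasing, [gammabar r * mes (Q_r(y)) = (c r)^d gamma (c r)] is at
    most [psi m n], hence [Vstar] on [Q_r(y)] at the threshold [gammabar r *
    mes] is at least [Vstar] on [Q(xi, n)] at the threshold [psi m n], and
    the latter tends to infinity with [l]. The upper limit is infinite
    because [r^(-2) gammabar r = c^(d+2) (c r)^(-2) gamma (c r)]. *)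

(** * Cubes and the rearrangement [Vstar] *)

Section cubes.
Context {R : realType} {d : nat}.
Implicit Types (x y z s : 'rV[R]_d) (r t : R).

Lemma cubeP r y x : 0 < r ->
  cube r y x <-> forall k, y 0 k <= x 0 k <= y 0 k + r.
Proof.
move=> r0; split=> [[u u01 <-] k|yx].
  by have := u01 k; rewrite !mxE => /andP[u0 u1]; apply/andP; split; nra.
exists (r^-1 *: (x - y)); last by rewrite scalerA divff ?gt_eqF// scale1r subrK.
move=> k; have /andP[yk xk] := yx k; rewrite !mxE; apply/andP; split.
  by rewrite mulr_ge0 ?subr_ge0// invr_ge0 ltW.
by rewrite mulrC ler_pdivrMr// mul1r lerBlDl.
Qed.

Lemma mes_cube r y : 0 < r -> mes (cube r y) = (r ^+ d)%:E.
Proof.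
move=> r0; rewrite (_ : cube r y = box y (y + const_mx r)).
  rewrite mes_box => [|k]; last by rewrite !mxE lerDl ltW.
  rewrite (eq_bigr (fun=> r)) ?prodr_const ?card_ord// => k _.
  by rewrite !mxE; ring.
apply/seteqP; split=> x.
  by move=> /(cubeP _ _ r0) yx k; have := yx k; rewrite !mxE.
by move=> yx; apply/(cubeP _ _ r0) => k; have := yx k; rewrite !mxE.
Qed.

(** [Vstar] increases when the set grows or when the measure threshold drops. *)
Lemma le_Vstar (W : 'rV[R]_d -> R) (t t' : \bar R) (E E' : set 'rV[R]_d) :
  (t' <= t)%E -> E `<=` E' -> (Vstar W t E <= Vstar W t' E')%E.
Proof.
move=> tt' EE'; apply: ereal_sup_le => _ [->|[s [s0 ts] <-]]; first by left.
right; exists s => //; split=> //; apply: le_trans tt' (le_trans ts _).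
by apply: le_outer_measure => x [Ex sx]; split=> //; exact: EE'.
Qed.

(** The reason: in each coordinate, one of the two halves of a side of length
    at most 1 lies between consecutive integers. *)
Lemma half_cube_in_unit_cube r y : 0 < r <= 1 ->
  exists (l : 'rV[int]_d) z,
    [/\ `|y - intvec l| <= 1, cube (r / 2) z `<=` cube r y
      & cube (r / 2) z `<=` cube 1 (intvec l)].
Proof.
move=> /andP[r0 r1].
pose f k : int := Num.floor (y 0 k).
have fP k : (f k)%:~R <= y 0 k < (f k)%:~R + 1.
  by have := floor_itv (y 0 k); rewrite intrD.
pose b k := y 0 k + r / 2 <= (f k)%:~R + 1.
exists (\row_k if b k then f k else f k + 1).
exists (\row_k if b k then y 0 k else y 0 k + r / 2).
have r20 : 0 < r / 2 by rewrite divr_gt0.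
split.
- rewrite /Num.Def.normr/= mx_normrE; apply: bigmax_le => // -[i k] _ /=.
  rewrite !ord1 !mxE; have /andP[? ?] := fP k.
  by case: ifP => _; rewrite ?intrD ler_norml; apply/andP; split; lra.
- move=> x /(cubeP _ _ r20) zx; apply/(cubeP _ _ r0) => k.
  have := zx k; rewrite !mxE.
  by case: ifP => _ /andP[? ?]; apply/andP; split; lra.
- move=> x /(cubeP _ _ r20) zx; apply/(cubeP _ _ ltr01) => k.
  have := zx k; rewrite !mxE; have /andP[? ?] := fP k.
  case: (boolP (b k)); rewrite /b -?ltNge ?intrD => ? /andP[? ?].
    by apply/andP; split; lra.
  by apply/andP; split; lra.
Qed.

Lemma lattice_cube_in_cube (m n : nat) t s : (0 < m)%N ->
  2 * m%:R ^- n <= t ->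
  exists2 xi, lattice m n xi & cubem m n xi `<=` cube t s.
Proof.
move=> m0 nt; set e : R := m%:R ^- n in nt *.
have e0 : 0 < e by rewrite invr_gt0 exprn_gt0// ltr0n.
have t0 : 0 < t by lra.
pose c k : int := Num.ceil (s 0 k / e).
(* Rounding [s] up to the lattice moves each coordinate by less than [e]. *)
exists (e *: intvec (\row_k c k)); first by exists (\row_k c k).
move=> x /(cubeP _ _ e0) cx; apply/(cubeP _ _ t0) => k.
have /andP[] := cx k; rewrite !mxE => x1 x2.
have c1 : s 0 k <= e * (c k)%:~R by rewrite mulrC -ler_pdivrMr// ceil_ge.
have c2 : e * ((c k)%:~R - 1) < s 0 k.
  rewrite mulrC -ltr_pdivlMr//.
  by have := ceilB1_lt (s 0 k / e); rewrite intrB.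
by apply/andP; split; lra.
Qed.

End cubes.

(** * Exponents and infinite limits *)

Section scales.
Context {R : realType}.

(** A power of [m] comparable with [x] whose exponent bounds the integer part
    of the logarithm of [x]. *)
Lemma exists_exponent (m : nat) (x : R) : (1 < m)%N -> 1 <= x ->
  exists n : nat,
    [/\ (1 <= n)%N,
        forall j : nat, j%:Z <= Num.floor (logb m x) -> (j <= n)%N
      & 2 * x <= m%:R ^+ n <= m%:R ^+ 2 * x].
Proof.
move=> m1 x1.
have m2 : 2 <= m%:R :> R by rewrite ler_nat.
have m0 : 0 < m%:R :> R by lra.
have lm : 0 < ln (m%:R : R) by rewrite ln_gt0// ltr1n.
have x0 : 0 < x by lra.
have L0 : 0 <= logb m x by apply: divr_ge0; [exact: ln_ge0|exact: ltW].
have [N EN] : exists N : nat, Num.floor (logb m x) = N%:Z.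
  by exists `|Num.floor (logb m x)|%N; rewrite gez0_abs// floor_ge0.
have := floor_itv (logb m x); rewrite EN -PoszD addn1 !pmulrn.
rewrite /logb ler_pdivlMr// ltr_pdivrMr// !mulr_natl -!lnXn//.
rewrite ler_ln ?ltr_ln ?posrE ?exprn_gt0// => /andP[N1 N2].
(* One unit above [N] passes [x], the other gives the factor [2 <= m]. *)
exists N.+2; split=> // [j|].
  by rewrite lez_nat => jN; rewrite ltnW// ltnW.
by rewrite exprSr exprS in N2 *; apply/andP; split; rewrite ?exprS; nra.
Qed.

Lemma limf_esup_right0_pinftyP (f : R -> R) :
  limf_esup (fun r => (f r)%:E) (0 : R)^'+ = +oo%E <->
  forall e M, 0 < e -> exists2 r, 0 < r < e & M < f r.
Proof.
rewrite limf_esupE; split=> [fy e M e0|fM].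
  have : (M%:E < ereal_sup [set (f r)%:E | r in [set r : R | (0 < r < e)%R]])%E.
    apply: (@lt_le_trans _ _ +oo%E); first exact: ltry.
    rewrite -fy; apply: ereal_inf_lbound; exists [set r : R | 0 < r < e] => //.
    near=> r; rewrite /=; apply/andP; split; near: r.
      exact: nbhs_right_gt.
    exact: nbhs_right_lt.
  move=> /ereal_sup_gt[_ [r re <-]]; rewrite lte_fin => Mr.
  by exists r.
apply/eqP; rewrite -leye_eq; apply: le_ereal_inf_tmp => _ [A A0 <-].
have [e /= e0 eA] := A0.
rewrite leye_eq; apply/eqP/eqyP => M M0.
have [r /andP[r0 re] Mr] := fM e M e0.
apply: le_trans (ereal_sup_ubound _); last first.
  exists r; first apply: eA => //=; last by [].
  by rewrite sub0r normrN gtr0_norm.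
by rewrite lee_fin ltW.
Unshelve. all: by end_near. Qed.

Lemma to_infty_cvgyP (T : Type) d (i : T -> 'rV[R]_d) (f : T -> \bar R) :
  f t @[t --> to_infty i] --> +oo%E <->
  forall A : R, exists M : R, forall t, M < `|i t| -> (A%:E < f t)%E.
Proof.
split=> [fy A|fA P [A [_ AP]]].
  have [|M _ Mf] := fy [set x | (A%:E < x)%E]; last by exists M.
  by exists A; split; first exact: num_real.
by have [M Mf] := fA A; exists M => // t Mt; exact/AP/Mf.
Qed.

End scales.

(** * From dense systems to lattice cubes *)

(** The cube of side [theta * r] provided by density contains a cell of every
    grid of mesh at most half its side; [n] bounds the index of the term of [D]
    that contains this cube. *)
Lemma dense_system_Xi (R : realType) (d m : nat) (theta : R) (y z : 'rV[R]_d)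
    (D : nat -> set 'rV[R]_d) (r : R) (n : nat) :
  (0 < m)%N -> dense_system m theta y D ->
  0 < r -> r < Num.min 1 (1 / (theta * m%:R ^+ 2)) ->
  cube r z `<=` cube 1 y ->
  (forall j : nat,
    j%:Z <= Num.floor (logb m (1 / (theta * r))) -> (j <= n)%N) ->
  2 * m%:R ^- n <= theta * r ->
  exists xi, (\bigcup_(j in [set j | (1 <= j <= n)%N]) Xi m n (D j)) xi /\
    cubem m n xi `<=` cube r z.
Proof.
move=> m0 [_ _ dense] r0 rm rz jn nr.
have [j [j1 jr [P [s [_ PD sP]]]]] := dense r z r0 rm rz.
have [xi lxi xis] := lattice_cube_in_cube s m0 nr.
exists xi; split; last by move=> x /xis /sP[].
exists j; first by rewrite /= j1 jn.
by split=> // x /xis /sP[/PD].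
Qed.

(* The union of the sets Xi is finite and non-empty, so that the [ereal_inf]
   below is a minimum. *)
Theorem proposition4p2 (R : realType) (d : nat) (V : 'rV[R]_d -> R)
  (m : nat) (theta : R) (D : 'rV[int]_d -> nat -> set 'rV[R]_d)
  (r0 : R) (gamma : R -> R) :
  (3 <= d)%N ->
  L1loc V -> (forall x, 0 <= V x) ->
  (1 < m)%N -> 0 < theta < 1 ->
  (forall l, dense_system m theta (intvec l) (D l)) ->
  (forall l n j, (1 <= j <= n)%N -> Xi m n (D l j) !=set0) ->
  1 / m%:R < r0 ->
  (forall r, 0 < r < r0 -> 0 < gamma r < 1) ->
  (forall r s, 0 < r < r0 -> 0 < s < r0 -> r <= s -> gamma r <= gamma s) ->
  limf_esup (fun r : R => (r ^- 2 * gamma r)%:E) (0 : R)^'+ = +oo%E ->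
  (forall n, (1 <= n)%N ->
    ereal_inf [set Vstar V (psi (d := d) gamma m n) (cubem m n xi) | xi in
      \bigcup_(j in [set j | (1 <= j <= n)%N]) Xi m n (D l j)]
    @[l --> to_infty (@intvec R d)] --> +oo%E) ->
  exists (rbar0 : R) (gammabar : R -> R),
    [/\ 0 < rbar0,
        forall r, 0 < r <= rbar0 -> 0 < gammabar r < 1,
        limf_esup (fun r : R => (r ^- 2 * gammabar r)%:E) (0 : R)^'+ = +oo%E
      & forall r, 0 < r <= rbar0 ->
          Vstar V ((gammabar r)%:E * mes (cube r y))%E (cube r y)
          @[y --> to_infty (@id 'rV[R]_d)] --> +oo%E].
Proof.
move=> _ _ _ m1 /andP[th0 th1] dense _ mr0 gamma01 gamma_nd gamma_limsup Vlim.
have m2 : 2 <= m%:R :> R by rewrite ler_nat.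
have m0 : 0 < m%:R :> R by lra.
pose c : R := theta / (2 * m%:R ^+ 2).
have c0 : 0 < c by rewrite divr_gt0// mulr_gt0// exprn_gt0.
have cm : c < 1 / m%:R.
  rewrite ltr_pdivrMr ?mulr_gt0 ?exprn_gt0//.
  rewrite [ltRHS](_ : _ = 2 * m%:R); first lra.
  by field; rewrite gt_eqF.
have c1 : c < 1 by apply: (lt_le_trans cm); rewrite ler_pdivrMr//; lra.
(* Every [r <= a] makes [r / 2] an admissible side in the density condition. *)
pose a : R := Num.min 1 (1 / (theta * m%:R ^+ 2)).
have a0 : 0 < a by rewrite lt_min ltr01 divr_gt0// mulr_gt0// exprn_gt0.
have a1 : a <= 1 by rewrite ge_min lexx.
have am : a * (theta * m%:R ^+ 2) <= 1.
  by rewrite -ler_pdivlMr ?mulr_gt0 ?exprn_gt0// ge_min lexx orbT.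
have cr0 r : 0 < r <= a -> 0 < c * r < r0.
  move=> /andP[rp ra]; rewrite mulr_gt0//=; apply: le_lt_trans mr0.
  by apply: le_trans (ltW cm); rewrite ler_piMr ?(ltW c0)//; lra.
exists a, (fun r => c ^+ d * gamma (c * r)); split=> //.
- move=> r /cr0/gamma01/andP[g0 g1]; rewrite mulr_gt0 ?exprn_gt0//=.
  by rewrite (@le_lt_trans _ _ (gamma (c * r)))// ler_piMl ?exprn_ile1// ltW.
- move/limf_esup_right0_pinftyP in gamma_limsup.
  apply/limf_esup_right0_pinftyP => e M e0.
  (* A large value of [gamma] at [r] is turned into one of [gammabar] at
     [r / c], at the cost of the constant factor [c ^+ d.+2]. *)
  have [r /andP[rp re] Mr] :=
    gamma_limsup (c * e) (M / c ^+ d.+2) (mulr_gt0 c0 e0).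
  exists (r / c); first by rewrite divr_gt0//= ltr_pdivrMr// mulrC.
  rewrite (mulrC c) divfK ?gt_eqF//.
  move: Mr; rewrite ltr_pdivrMr ?exprn_gt0// => /lt_le_trans; apply.
  rewrite le_eqVlt; apply/orP; left; apply/eqP.
  rewrite -(addn2 d) exprD; field.
  by rewrite !gt_eqF.
move=> r ra; have /andP[rp rle] := ra.
have tr0 : 0 < theta * (r / 2) by rewrite mulr_gt0// divr_gt0.
have x1 : 1 <= 1 / (theta * (r / 2)).
  by rewrite ler_pdivlMr// mul1r; nra.
have [n [n1 jn]] := exists_exponent m1 x1.
rewrite !div1r ler_pdivrMr// ler_pdivlMr// => /andP[n2 n3].
have mn0 : 0 < m%:R ^+ n :> R by rewrite exprn_gt0.
have nr : 2 * m%:R ^- n <= theta * (r / 2) by rewrite ler_pdivrMr// mulrC.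
have crn : c * r <= m%:R ^- n.
  rewrite -[leRHS]mul1r ler_pdivlMr// /c.
  rewrite [X in X <= _](_ : _ = m%:R ^+ n * (theta * (r / 2)) / m%:R ^+ 2).
    by rewrite ler_pdivrMr ?exprn_gt0// mul1r.
  by field; rewrite gt_eqF.
have nr0 : 0 < (m%:R ^- n : R) < r0.
  rewrite invr_gt0 mn0/=; apply: le_lt_trans mr0.
  by rewrite mul1r lef_pV2 ?posrE// -[leLHS]expr1 ler_weXn2l//; lra.
(* The new threshold on [Q_r(y)] is below [psi m n]. *)
have threshold (y : 'rV[R]_d) :
    ((c ^+ d * gamma (c * r))%:E * mes (cube r y) <= psi (d := d) gamma m n)%E.
  rewrite /psi /cubem !mes_cube ?(andP nr0).1// -!EFinM lee_fin.
  rewrite -mulrA mulrCA -exprMn ler_pM//.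
  - by rewrite ltW// (andP (gamma01 _ (cr0 _ ra))).1.
  - by rewrite exprn_ge0// ltW// (andP (cr0 _ ra)).1.
  - exact: gamma_nd (cr0 _ ra) nr0 crn.
  - by rewrite lerXn2r// nnegrE ltW// ?(andP (cr0 _ ra)).1 ?(andP nr0).1.
apply/to_infty_cvgyP => A.
have [M MA] := (to_infty_cvgyP _ _).1 (Vlim n n1) A.
exists (M + 1) => y My.
have [|l [z [yl zy zl]]] := @half_cube_in_unit_cube _ _ r y.
  by rewrite rp (le_trans rle a1).
have Ml : M < `|intvec l : 'rV[R]_d|.
  by have := ler_normD (y - intvec l) (intvec l); rewrite subrK; lra.
have [||xi [xiD xiz]] := dense_system_Xi (ltnW m1) (dense l) _ _ zl jn nr.
- by rewrite divr_gt0.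
- by rewrite -/a; lra.
apply: lt_le_trans (MA l Ml) _; apply: le_trans (ereal_inf_lbound _) _.
  by exists xi.
by apply: le_Vstar; [exact: threshold|exact: subset_trans zy].
Qed.
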